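(* Let $\phi:[0,\infty)\to\mathbb{R}$ be lower semi-continuous and increasing on $[0,\infty)$ with $\phi(0)=0$. Let $a\in\mathbb{R}^n$, $\tilde\lambda>0$ and $r\in\{0,1,\ldots,n-1\}$. Let $\mathcal I^*$ be the index set corresponding to the $n-r$ smallest entries of $|a|$, and let $x^*\in\mathbb{R}^n$ be defined by $$x_i^*\in\begin{cases}\underset{u\in\mathbb{R}}{\mathrm{Argmin}}\ \left\{\tfrac12(u-a_i)^2+\tilde\lambda\,\phi(|u|)\right\}&\text{if } i\in\mathcal I^*,\\ \{a_i\}&\text{otherwise,}\end{cases}\qquad i=1,\ldots,n.$$ Then $x^*$ is an optimal solution of the problem $$\min_{x\in\mathbb{R}^n}\Big\{\tfrac12\|x-a\|^2+\tilde\lambda\sum_{i=r+1}^n\phi(|x|_{[i]})\Big\}.$$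
   Context: $\|\cdot\|$ is the Euclidean norm. $|a|$ is the vector of absolute values of the entries of $a$. $|x|_{[i]}$ denotes the $i$th largest element of $\{|x_1|,\ldots,|x_n|\}$ (counted with multiplicity). $\mathrm{Argmin}$ is the set of all minimizers. ''Increasing'' is meant in the weak sense. *)

(* Defs.v *)
From HB Require Import structures.
From mathcomp Require Import all_boot all_order all_algebra.
From mathcomp Require Import all_classical all_reals all_analysis.

Set Implicit Arguments.
Unset Strict Implicit.
Unset Printing Implicit Defensive.

Import Order.TTheory GRing.Theory Num.Theory.
Import numFieldNormedType.Exports.

Local Open Scope classical_set_scope.
Local Open Scope ring_scope.

Definition Argmin (R : realType) (T : Type) (f : T -> R) : set T :=
  [set x | forall y, f x <= f y].

(* The norm `|x| that matrices carry in the library is the sup norm. *)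
Definition norm2 (R : realType) (n : nat) (x : 'rV[R]_n) : R :=
  Num.sqrt (\sum_(i < n) x 0 i ^+ 2).

(* |x|_[k], counted from k = 1: the k-th largest of the |x_i|, with
   multiplicity. The values at k = 0 and k > n are junk. *)
Definition abs_nth_largest (R : realType) (n : nat) (x : 'rV[R]_n) (k : nat) : R :=
  nth 0 (sort (fun s t : R => t <= s) [seq `|x 0 i| | i <- enum 'I_n]) k.-1.

(* Under ties several sets I qualify. *)
Definition smallest_abs_entries (R : realType) (n : nat) (a : 'rV[R]_n)
    (m : nat) (I : {set 'I_n}) : Prop :=
  #|I| = m /\ forall i j, i \in I -> j \notin I -> `|a 0 i| <= `|a 0 j|.

(* A function on [0, +oo[ is given by a total phi : R -> R; the points outside
   [0, +oo[ are isolated in the subspace topology, so they impose nothing. *)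
Definition lsc_on_nonneg (R : realType) (phi : R -> R) : Prop :=
  lower_semicontinuous (fun t : subspace (`[0, +oo[ : set R) => (phi t)%:E).

Definition objective (R : realType) (n : nat) (phi : R -> R) (a : 'rV[R]_n)
    (lambda : R) (r : nat) (x : 'rV[R]_n) : R :=
  2^-1 * norm2 (x - a) ^+ 2
  + lambda * \sum_(r.+1 <= i < n.+1) phi (abs_nth_largest x i).

(* Main.v *)
Require Import Defs.
From mathcomp Require Import all_boot all_order all_algebra.
From mathcomp Require Import all_classical all_reals all_analysis.

Import Order.TTheory GRing.Theory Num.Theory.
Import numFieldNormedType.Exports.

Local Open Scope classical_set_scope.
Local Open Scope ring_scope.

(** Write [g_i(u) = (u - a_i)^2 / 2 + lambda phi(|u|)] and let [v_i] be its
    minimum for [i] in [I]. The claim follows from the chain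
      [objective x <= \sum_(i in I) v_i <= \sum_(j in J) g_j(y_j) <= objective y]
    where [y] is arbitrary and [J] indexes the [n - r] smallest entries of [|y|].

    The penalty of a vector is the sum of [phi] over the indices of its [n - r]
    smallest absolute values ([penalty_smallest_abs_entries]); as [phi] is
    increasing, no other set of [n - r] indices gives a smaller sum. Applied to
    [x] and [I], this gives the first inequality, since [x] agrees with [a] off
    [I]. The last inequality only drops the nonnegative terms
    [(y_j - a_j)^2 / 2] with [j] outside [J].

    The middle inequality compares sums over two different index sets. The
    infimum of [g_i] increases with [|a_i|] ([prox_objective_mono]), so
    [v_i <= g_j(y_j)] as soon as [|a_i| <= |a_j|], which is the case for [i] in [I] and [j] outside [I].
    An exchange argument on sets of equal size ([ler_sum_exchange]) then gives
    the inequality. The same exchange argument shows that the smallest entries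
    minimize the penalty. *)

(** An element of [J] outside [I] pays for any element of [I] outside [J], and
    both kinds are equally numerous. *)
Lemma ler_sum_exchange (R : realDomainType) (T : finType) (I J : {set T})
    (f g : T -> R) :
    #|I| = #|J| -> (forall i, i \in I -> f i <= g i) ->
    (forall i j, i \in I -> j \notin I -> f i <= g j) ->
  \sum_(i in I) f i <= \sum_(j in J) g j.
Proof.
move=> cardIJ fg_in fg_out.
have [I0|[i0 i0I]] := set_0Vmem I.
  suff -> : J = finset.set0 by rewrite I0 !big_set0.
  by apply/eqP; rewrite -cards_eq0 -cardIJ I0 cards0.
(* The largest f m over I separates the values of f on I :\: J from those of
   g on J :\: I. *)
case: (@arg_maxP _ _ _ i0 (mem I) f i0I) => m mI f_max.
rewrite (big_setID J) [leRHS](big_setID I) /= [J :&: I]finset.setIC; apply: lerD.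
  by apply: ler_sum => i; rewrite inE => /andP[iI _]; apply: fg_in.
apply: (@le_trans _ _ (\sum_(i in I :\: J) f m)).
  by apply: ler_sum => i; rewrite inE => /andP[_ iI]; apply: f_max.
have -> : \sum_(i in I :\: J) f m = \sum_(j in J :\: I) f m.
  rewrite !sumr_const; congr (_ *+ _); apply/eqP.
  by rewrite -(eqn_add2l #|I :&: J|) cardsID cardIJ finset.setIC cardsID.
by apply: ler_sum => j; rewrite inE => /andP[jI _]; apply: fg_out.
Qed.

(** Listing the indices, rather than the values, by decreasing absolute value
    turns the sum over the tail of the sorted values into a sum over a set of
    indices. *)
Lemma penalty_smallest_abs_entries (R : realType) (n : nat) (phi : R -> R)
    (r : nat) (x : 'rV[R]_n) :
  exists2 J : {set 'I_n}, smallest_abs_entries x (n - r) J &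
    \sum_(r.+1 <= i < n.+1) phi (abs_nth_largest x i)
      = \sum_(i in J) phi `|x 0 i|.
Proof.
pose ge_abs := fun i j : 'I_n => `|x 0 j| <= `|x 0 i|.
pose s := sort ge_abs (enum 'I_n).
have size_s : size s = n by rewrite size_sort size_enum_ord.
have uniq_s : uniq s by rewrite sort_uniq enum_uniq.
have mem_s i : i \in s by rewrite mem_sort mem_enum.
have s_cat : s = take r s ++ drop r s by rewrite cat_take_drop.
have : pairwise ge_abs s.
  rewrite -sorted_pairwise; first by apply: sort_sorted => i j; exact: le_total.
  by move=> j i k; rewrite /ge_abs => ij jk; exact: le_trans jk ij.
rewrite s_cat pairwise_cat => /and3P[/allrelP ge_take_drop _ _].
exists [set i in drop r s]%SET.
  split; first by rewrite cardsE (card_uniqP _) ?drop_uniq // size_drop size_s.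
  move=> i j; rewrite !inE => i_drop j_drop; apply: ge_take_drop => //.
  by have := mem_s j; rewrite {1}s_cat mem_cat (negbTE j_drop) orbF.
transitivity (\sum_(j <- drop r s) phi `|x 0 j|).
  have sorted_abs : sort (fun u v : R => v <= u) [seq `|x 0 i| | i <- enum 'I_n]
      = [seq `|x 0 i| | i <- s] by rewrite sort_map.
  rewrite big_add1 /= -(big_map (fun j => `|x 0 j|) predT phi) map_drop.
  rewrite [RHS](big_nth 0) size_drop size_map size_s.
  rewrite -{1}(add0n r) big_addn; apply: eq_bigr => i _.
  by rewrite /abs_nth_largest /= sorted_abs nth_drop addnC.
rewrite big_uniq ?drop_uniq //; apply: eq_bigl => i; by rewrite inE.
Qed.

(** The infimum over [u] depends on the centre [a] through [|a|] only, and
    increases with it. If [|u| < |b|], a point of absolute value [|u|] on the side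
    of [b] is no farther from [b] than [u] is from [a]. Otherwise [b] itself costs
    nothing in the quadratic term and at most [phi |u|] in the other. *)
Lemma prox_objective_mono (R : realType) (phi : R -> R) (lambda a b u : R) :
    (forall s t : R, 0 <= s -> s <= t -> phi s <= phi t) -> 0 <= lambda ->
    `|b| <= `|a| ->
  exists w : R, 2^-1 * (w - b) ^+ 2 + lambda * phi `|w|
                  <= 2^-1 * (u - a) ^+ 2 + lambda * phi `|u|.
Proof.
move=> phi_incr lambda_ge0 le_ba.
have [le_bu|lt_ub] := leP `|b| `|u|.
  exists b; rewrite subrr expr0n mulr0 add0r.
  apply: ler_wpDl; first by rewrite mulr_ge0 ?invr_ge0 ?sqr_ge0.
  by apply: ler_wpM2l => //; apply: phi_incr.
(* The point with the absolute value of u on the same side of 0 as b is at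
   distance `|b| - `|u| from b, the least possible. *)
exists (Num.sg b * `|u|).
have b_neq0 : b != 0 by rewrite -normr_gt0 (le_lt_trans _ lt_ub).
have -> : `|Num.sg b * `|u| | = `|u|.
  by rewrite normrM normr_sg b_neq0 mul1r normr_id.
rewrite lerD2r; apply: ler_wpM2l; first by rewrite invr_ge0.
have -> : Num.sg b * `|u| - b = Num.sg b * (`|u| - `|b|).
  by rewrite mulrBr -numEsg.
rewrite exprMn sqr_sg b_neq0 mul1r.
rewrite -[(u - a) ^+ 2]real_normK ?num_real //
  -[(`|u| - _) ^+ 2]real_normK ?num_real //.
rewrite lerXn2r ?nnegrE // (le_trans _ (_ : `|a| - `|u| <= _)) //;
  last by rewrite distrC lerB_dist.
by rewrite distrC ger0_norm ?subr_ge0 ?(ltW lt_ub) // lerD2r.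
Qed.

Lemma half_norm2_sqr (R : realType) (n : nat) (x : 'rV[R]_n) :
  2^-1 * norm2 x ^+ 2 = \sum_(i < n) 2^-1 * x 0 i ^+ 2.
Proof.
rewrite /norm2 sqr_sqrtr ?mulr_sumr // sumr_ge0 // => i _; exact: sqr_ge0.
Qed.

Theorem theorem5p5 (R : realType) (phi : R -> R)
    (phi_lsc : lsc_on_nonneg phi)
    (phi_incr : forall s t : R, 0 <= s -> s <= t -> phi s <= phi t)
    (phi0 : phi 0 = 0)
    (n : nat) (a : 'rV[R]_n) (lambda : R) (lambda_gt0 : 0 < lambda)
    (r : nat) (r_lt_n : (r < n)%N)
    (I : {set 'I_n}) (HI : smallest_abs_entries a (n - r)%N I)
    (x : 'rV[R]_n)
    (Hx : forall i : 'I_n,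
       (if i \in I
        then Argmin (fun u : R => 2^-1 * (u - a 0 i) ^+ 2 + lambda * phi `|u|)
        else [set a 0 i]) (x 0 i)) :
  Argmin (objective phi a lambda r) x.
Proof.
have lambda_ge0 := ltW lambda_gt0.
case: HI => card_I a_I.
pose g i u := 2^-1 * (u - a 0 i) ^+ 2 + lambda * phi `|u|.
have x_min i u : i \in I -> g i (x 0 i) <= g i u.
  by move=> iI; have := Hx i; rewrite iI; apply.
have x_out i : i \notin I -> x 0 i = a 0 i.
  by move=> iI; have := Hx i; rewrite (negbTE iI).
move=> y; apply: (@le_trans _ _ (\sum_(i in I) g i (x 0 i))).
  have [K [card_K x_K] pen_x] := penalty_smallest_abs_entries _ _ phi r x.
  rewrite /objective half_norm2_sqr pen_x big_split /= -[X in _ <= _ + X]mulr_sumr.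
  apply: lerD; last first.
    apply: ler_wpM2l => //; apply: ler_sum_exchange => // [|i j iK jK].
      by rewrite card_K card_I.
    by apply: phi_incr => //; exact: x_K.
  rewrite (bigID (mem I)) /= [X in _ + X]big1 ?addr0 => [|i /x_out xi].
    by apply: ler_sum => i _; rewrite !mxE.
  by rewrite !mxE xi subrr expr0n mulr0.
have [J [card_J _] pen_y] := penalty_smallest_abs_entries _ _ phi r y.
apply: (@le_trans _ _ (\sum_(j in J) g j (y 0 j))).
  apply: ler_sum_exchange => [|i iI|i j iI jI]; first by rewrite card_I card_J.
    exact: x_min.
  have [w le_w] := prox_objective_mono _ _ _ _ _ (y 0 j) phi_incr lambda_ge0 (a_I _ _ iI jI).
  exact: le_trans (x_min i w iI) le_w.
rewrite /objective half_norm2_sqr pen_y big_split /=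
  -[X in _ + X <= _]mulr_sumr lerD2r.
rewrite [leRHS](bigID (mem J)) /=; apply: ler_wpDr.
  by apply: sumr_ge0 => j _; rewrite mulr_ge0 ?invr_ge0 ?sqr_ge0.
by apply: ler_sum => j _; rewrite !mxE.
Qed.
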